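(* For every setting $(N,M,\boldsymbol q)$, the Probabilistic Serial mechanism $\mathrm{PS}$ is weakly less varying than the Random Serial Dictatorship mechanism $\mathrm{RSD}$; that is, for any agent $i\in N$, any preference profile $(P_i,P_{-i})\in\mathcal P^N$, and any $P_i'\in N_{P_i}$, $\mathrm{RSD}_i(P_i,P_{-i})=\mathrm{RSD}_i(P_i',P_{-i})$ implies $\mathrm{PS}_i(P_i,P_{-i})=\mathrm{PS}_i(P_i',P_{-i})$.
   Context: A setting $(N,M,\boldsymbol q)$ consists of a finite set $N$ of $n$ agents, a finite set $M$ of $m$ objects, and a vector $\boldsymbol q=(q_j)_{j\in M}$ of capacities (positive integers; there are $q_j$ units of object $j$) with $n\le\sum_{j\in M}q_j$. $\mathcal P$ is the set of strict preference orders (linear orders) over $M$. A preference profile is an element $(P_i,P_{-i})\in\mathcal P^N$, where $P_{-i}$ are the orders of all agents except $i$. The neighborhood $N_P$ of $P\in\mathcal P$ is the set of orders obtained from $P$ by swapping two objects that are adjacent in $P$. An assignment is an $N\times M$ matrix $x$ with $x_{i,j}\in[0,1]$, $\sum_{j\in M}x_{i,j}=1$ for all $i$, and $\sum_{i\in N}x_{i,j}\le q_j$ for all $j$. A mechanism maps each preference profile to an assignment; for a mechanism $\varphi$, $\varphi_i(P_i,P_{-i})$ denotes the row (assignment vector) of agent $i$. Random Serial Dictatorship (RSD): an ordering of the agents is drawn uniformly at random from all $n!$ orderings; in this order, each agent receives the object it most prefers (according to its reported order) among the objects with remaining capacity. $\mathrm{RSD}_{i,j}(\boldsymbol P)$ is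 the resulting probability that agent $i$ receives object $j$. Probabilistic Serial (PS): objects are treated as divisible, object $j$ having total amount $q_j$. During the time interval $[0,1]$, each agent at each time consumes, at unit speed, its most preferred object (according to its reported order) among those whose capacity is not yet completely consumed. When an object is exhausted, all agents consuming it move on to their next most preferred object that is not yet exhausted. The process ends at time $1$, when all agents have collected a total of $1$ unit. $\mathrm{PS}_{i,j}(\boldsymbol P)$ is the amount of object $j$ consumed by agent $i$. *)

(* Defs.v *)
(* Mathematical Components. *)
From mathcomp Require Import all_boot all_order all_algebra perm.

Set Implicit Arguments.
Unset Strict Implicit.
Unset Printing Implicit Defensive.

Import Order.TTheory GRing.Theory Num.Theory.
Local Open Scope ring_scope.

(* [P a b] means that [a] is strictly preferred to [b]. *)
Record pref (M : finType) := Pref {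
  prefers :> rel M;
  _ : irreflexive prefers;
  _ : transitive prefers;
  _ : forall a b, a != b -> prefers a b || prefers b a
}.

Definition adjacent (M : finType) (P : pref M) (a b : M) : Prop :=
  P a b /\ (forall c, ~~ (P a c && P c b)).

(* [P'] belongs to the neighborhood of [P]; exchanging the names [a] and [b] in
   an order swaps the positions of the two objects. *)
Definition neighbor (M : finType) (P P' : pref M) : Prop :=
  exists a b, adjacent P a b /\
    (forall x y, P' x y = P (tperm a b x) (tperm a b y)).

Definition top (M : finType) (P : pref M) (A : {set M}) : option M :=
  [pick j in A | [forall k in A, (k != j) ==> P j k]].

Definition profile (N M : finType) := N -> pref M.

(* The value at agent [i] is the row [phi_i(P)] of the assignment matrix. *)
Definition mechanism (R : realFieldType) (N M : finType) :=
  profile N M -> N -> {ffun M -> R}.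

Definition weakly_less_varying (R : realFieldType) (N M : finType)
    (psi phi : mechanism R N M) : Prop :=
  forall (i : N) (P : profile N M) (Pi' : pref M),
    neighbor (P i) Pi' ->
    phi P i = phi [eta P with i |-> Pi'] i ->
    psi P i = psi [eta P with i |-> Pi'] i.

Section RSD.

Variables (R : realFieldType) (N M : finType) (q : M -> nat).

(* The agents in [o] choose in turn, with [r j] units of [j] left at the start.
   [None] means that nothing was left (or that the agent is not in [o]). *)
Fixpoint serial_dictatorship (P : profile N M) (r : M -> nat) (o : seq N) :
    N -> option M :=
  if o is k :: o' then
    let c := top (P k) [set j | (0 < r j)%N] in
    let r' j := (r j - (c == Some j))%N in
    [eta serial_dictatorship P r' o' with k |-> c]
  else fun=> None.

Definition RSD : mechanism R N M := fun P i =>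
  [ffun j =>
    (count (fun o => serial_dictatorship P q o i == Some j)
       (permutations (enum N)))%:R / (#|N|`!)%:R].

End RSD.

Section PS.

Variables (R : realFieldType) (N M : finType) (q : M -> nat).

(* [x i j] is the amount of object [j] that agent [i] has consumed so far. *)
Implicit Type x : {ffun N -> {ffun M -> R}}.

Definition left_over x (j : M) : R := (q j)%:R - \sum_i x i j.

Definition eats (P : profile N M) x (i : N) : option M :=
  top (P i) [set j | 0 < left_over x j].

Definition eaters (P : profile N M) x (j : M) : nat :=
  #|[set i | eats P x i == Some j]|.

(* Time from [t] until the next exhaustion of an object, or until time 1 if that
   comes first. *)
Definition duration (P : profile N M) (t : R) x : R :=
  \big[Num.min/1 - t]_(j | (0 < eaters P x j)%N)
    (left_over x j / (eaters P x j)%:R).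

(* What each agent eats is constant between two exhaustions. *)
Definition ps_step (P : profile N M) (s : R * {ffun N -> {ffun M -> R}}) :=
  let: (t, x) := s in
  let d := duration P t x in
  (t + d, [ffun i => [ffun j => x i j + d *+ (eats P x i == Some j)]]).

(* Each step reaches time 1 or exhausts an object, and the objects cannot all be
   exhausted before time 1 when [#|N| <= \sum_j q j]; so [#|M|] steps reach
   time 1, after which [ps_step] changes nothing. *)
Definition PS : mechanism R N M := fun P i =>
  (iter #|M| (ps_step P) (0, [ffun=> [ffun=> 0]])).2 i.

End PS.

Arguments RSD R N {M} q.
Arguments PS R N {M} q.

(* Main.v *)
(* Let [a] be directly above [b] in [P i].  Swapping them affects the eating of
   agent [i] only if at some time [t < 1] agent [i] turns to [a] while [b] is also
   left.  By Hall's theorem the units of the objects exhausted by time [t] can be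
   given to agents other than [i], each to an agent that has eaten some of that
   object.  If these agents come first, in the order in which their objects are
   exhausted, each of them picks its object.  So agent [i], coming next, finds
   exactly the objects left at time [t] and picks [a] before the swap and [b]
   after it.  Since under no ordering the swap lets [i] gain [a], the
   RSD-probability of [a] drops strictly. *)
Require Import Defs.
From mathcomp Require Import all_boot all_order all_algebra.
From mathcomp Require Import perm.

Set Implicit Arguments.
Unset Strict Implicit.
Unset Printing Implicit Defensive.

Import Order.TTheory GRing.Theory Num.Theory.

(** * Hall's marriage theorem *)

Section Hall.

Variables I T : finType.

Definition hall_condition (F : I -> {set T}) :=
  forall J : {set I}, #|J| <= #|\bigcup_(i in J) F i|.

Let remove (F : I -> {set T}) i0 x i := if i == i0 then F i :\ x else F i.

(** A set violating the condition after the removal must contain [i0], as other unions are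
    unchanged; [J] is that set without [i0]. *)
Lemma hall_violation F i0 x : hall_condition F ->
    ~ hall_condition (remove F i0 x) ->
  exists2 J : {set I}, i0 \notin J &
    #|\bigcup_(i in J) F i :|: F i0 :\ x| <= #|J|.
Proof.
move=> hF nhF.
have /existsP[J] :
    [exists J : {set I}, #|\bigcup_(i in J) remove F i0 x i| < #|J|].
  apply: contraT => /existsPn h; case: nhF => J; rewrite leqNgt; exact: h.
have rmE (K : {set I}) : i0 \notin K ->
    \bigcup_(i in K) remove F i0 x i = \bigcup_(i in K) F i.
  move=> i0K; apply: eq_bigr => i iK; rewrite /remove ifN //.
  by apply: contraNneq i0K => <-.
have [i0J | i0J] := boolP (i0 \in J); last by rewrite rmE // ltnNge hF.
rewrite (bigD1 i0) //= {1}/remove eqxx (cardsD1 i0) i0J add1n ltnS => lt_J.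
exists (J :\ i0); first by rewrite !inE eqxx.
apply: leq_trans lt_J; rewrite setUC subset_leq_card // setUS //.
rewrite -rmE ?inE ?eqxx //; apply/bigcupsP => i; rewrite !inE => /andP[ni iJ].
by apply: bigcup_sup; rewrite iJ.
Qed.

(* Rado's proof: as long as some [F i] has two elements, one of them can be
   removed, because the cardinality of unions is submodular. *)
Lemma hall F : hall_condition F ->
  exists2 f : I -> T, injective f & forall i, f i \in F i.
Proof.
have [n] := ubnP (\sum_i #|F i|); elim: n F => // n IHn F le_n hF.
have [small | ] := boolP [forall i, #|F i| <= 1].
  have F1 i : exists x, F i = [set x].
    apply/cards1P; rewrite eqn_leq (forallP small) /=.
    by have := hF [set i]; rewrite cards1 big_set1.
  have [f fE] : exists f : I -> T, forall i, F i = [set f i].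
    have [f fE] := fin_all_exists F1; exists f => i; exact: fE.
  exists f => [i j fij | i]; last by rewrite fE set11.
  apply/eqP; apply: contraTT isT => nij.
  have := hF [set i; j]; rewrite cards2 nij bigcup_setU !big_set1 !fE fij setUid.
  by rewrite cards1.
case/forallPn => i0; rewrite -ltnNge => /card_gt1P[x [y [Fx Fy nxy]]].
have lt_n z : z \in F i0 -> \sum_i #|remove F i0 z i| < n.
  move=> Fz; rewrite -ltnS; apply: leq_trans le_n; rewrite ltnS.
  rewrite (bigD1 i0) //= [X in _ < X](bigD1 i0) //= -addSn leq_add //.
    by rewrite /remove eqxx [X in _ < X](cardsD1 z) Fz.
  by apply: leq_sum => i ni; rewrite /remove ifN.
have sub z i : remove F i0 z i \subset F i.
  by rewrite /remove; case: ifP => // _; rewrite subsetDl.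
have keep z : z \in F i0 -> hall_condition (remove F i0 z) ->
    exists2 f : I -> T, injective f & forall i, f i \in F i.
  move=> Fz h; have [f f_inj fF] := IHn _ (lt_n z Fz) h.
  by exists f => // i; rewrite (subsetP (sub z i)).
have dec z : hall_condition (remove F i0 z) \/ ~ hall_condition (remove F i0 z).
  have [/forallP h | nh] :=
    boolP [forall J : {set I}, #|J| <= #|\bigcup_(i in J) remove F i0 z i|].
    by left.
  by right => h; case/negP: nh; apply/forallP.
(* If either removal preserves Hall's condition, induction concludes; what remains is that both
   fail. *)
case: (dec x) => [/(keep x Fx)//|nx]; case: (dec y) => [/(keep y Fy)//|ny].
have [J J0 leJ] := hall_violation hF nx.
have [K K0 leK] := hall_violation hF ny.
set A := _ :|: _ in leJ; set B := _ :|: _ in leK.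
(* Since [x] and [y] differ, [A :|: B] contains all of [F i0], so Hall's condition for [J :|: K]
   together with [i0] gains one. *)
have leU : #|J :|: K|.+1 <= #|A :|: B|.
  have := hF (i0 |: (J :|: K)).
  rewrite cardsU1 !inE negb_or J0 K0 /= add1n => /leq_trans; apply.
  rewrite bigcup_setU big_set1 bigcup_setU.
  apply: subset_leq_card; apply/subsetP => z; rewrite !inE.
  case/orP => [Fz | /orP[->|->]]; rewrite ?orbT //.
  by rewrite Fz !andbT; case: eqVneq => [->|]; rewrite ?nxy ?orbT.
have leI : #|J :&: K| <= #|A :&: B|.
  apply: leq_trans (hF _) _; apply: subset_leq_card.
  by apply/bigcupsP => i; rewrite inE => /andP[iJ iK];
    rewrite subsetI !subsetU ?(bigcup_sup i).
(* The sum reads [#|J| + #|K| < #|A| + #|B|], against [leJ] and [leK]. *)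
have := leq_add leU leI.
by rewrite addSn !cardsUI ltnNge leq_add.
Qed.

End Hall.

(** * Strict orders and adjacent swaps *)

Section Preferences.

Variables (M : finType).
Implicit Types (P : pref M) (A : {set M}) (a b c : M).

Lemma pref_irr P : irreflexive P. Proof. by case: P. Qed.

Lemma pref_trans P : transitive P. Proof. by case: P. Qed.

Lemma pref_total P a b : a != b -> P a b || P b a.
Proof. by case: P a b. Qed.

Lemma pref_asym P a b : P a b -> P b a = false.
Proof.
by move=> ab; apply/negP => /(pref_trans ab); rewrite pref_irr.
Qed.

Definition is_top P A c := (c \in A) && [forall k in A, (k != c) ==> P c k].

Lemma is_topP P A c :
  reflect (c \in A /\ forall k, k \in A -> k != c -> P c k) (is_top P A c).
Proof.
apply: (iffP andP) => -[cA h]; split=> //.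
  by move=> k kA kc; move/forallP/(_ k): h; rewrite kA kc.
by apply/forallP => k; apply/implyP => kA; apply/implyP; apply: h.
Qed.

Lemma is_top_uniq P A c d : is_top P A c -> is_top P A d -> c = d.
Proof.
move=> /is_topP[cA cT] /is_topP[dA dT]; apply/eqP; apply: contraT => cd.
by have := cT d dA; rewrite eq_sym cd (pref_asym (dT c cA cd)) => /(_ isT).
Qed.

Lemma topP P A c : reflect (top P A = Some c) (is_top P A c).
Proof.
rewrite /top; case: pickP => [d dT | no]; last first.
  by apply: (iffP idP) => //; have := no c; rewrite /is_top /= => ->.
apply: (iffP idP) => [cT | [<-]//]; congr Some; exact: is_top_uniq dT cT.
Qed.

Lemma eq_top P P' A : is_top P A =1 is_top P' A -> top P A = top P' A.
Proof. by move=> e; apply: eq_pick => c; apply: e. Qed.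

Section Swap.

Variables (P P' : pref M) (a b : M).
Hypothesis adj : adjacent P a b.
Hypothesis swap : forall x y, P' x y = P (tperm a b x) (tperm a b y).

Lemma adjacent_out y : y != a -> y != b -> P a y = P b y /\ P y a = P y b.
Proof.
move=> ya yb; have [ab nab] := adj.
have /orP[h | h] : P a y || P y a by rewrite pref_total // eq_sym.
  have /orP[h'|h'] : P b y || P y b by rewrite pref_total // eq_sym.
    by rewrite h h' !(pref_asym h) !(pref_asym h').
  by have := nab y; rewrite h h'.
by rewrite h (pref_trans h ab) !(pref_asym h) (pref_asym (pref_trans h ab)).
Qed.

Lemma swap_out x y : (x, y) != (a, b) -> (x, y) != (b, a) -> P' x y = P x y.
Proof.
rewrite swap !xpair_eqE.
case: tpermP => [-> | -> | /eqP xa /eqP xb];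
  case: tpermP => [-> | -> | /eqP ya /eqP yb]; rewrite ?eqxx ?pref_irr //= => _ _.
- by have [-> _] := adjacent_out ya yb.
- by have [-> _] := adjacent_out ya yb.
- by have [_ ->] := adjacent_out xa xb.
- by have [_ ->] := adjacent_out xa xb.
Qed.

(** If [A] misses [a] or [b], both orders agree on [A]. Otherwise the transposition preserves [A]
    and carries one top to the other; a top that moves is [a] or [b], and [b] is below [a] in
    [P]. *)
Lemma top_swap A : top P' A <> top P A -> top P A = Some a /\ top P' A = Some b.
Proof.
have [/andP[aA bA] | nab] := boolP ((a \in A) && (b \in A)); last first.
  case; apply: eq_top => c; rewrite /is_top; case cA: (c \in A) => //=.
  apply: eq_forallb => k; case kA: (k \in A) => //=; rewrite swap_out //.
    by apply: contraNneq nab => -[<- <-]; rewrite cA kA.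
  by apply: contraNneq nab => -[<- <-]; rewrite cA kA.
have tA z : (tperm a b z \in A) = (z \in A) by case: tpermP => // ->; rewrite aA bA.
have topS c : is_top P A c -> is_top P' A (tperm a b c).
  move=> /is_topP[cA cT]; apply/is_topP; rewrite tA; split=> // k kA kc.
  by rewrite swap tpermK cT ?tA // -(inj_eq (@perm_inj _ (tperm a b))) tpermK.
have topS' c : is_top P' A c -> is_top P A (tperm a b c).
  move=> /is_topP[cA cT]; apply/is_topP; rewrite tA; split=> // k kA kc.
  rewrite -[k](tpermK a b) -swap cT ?tA //.
  by rewrite -(inj_eq (@perm_inj _ (tperm a b))) tpermK.
case e: (top P A) => [c|]; last first.
  case e': (top P' A) => [c|] // _.
  by move/topP/topS'/topP: e'; rewrite e.
move/topP: e => cT; have /topP -> := topS c cT.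
case: tpermP cT => [-> //|-> | _ _ //] /is_topP[_ /(_ a aA)].
have [ab _] := adj; rewrite (pref_asym ab); case: eqVneq => [e|_ /(_ isT)//].
by move: ab; rewrite e pref_irr.
Qed.

End Swap.

End Preferences.

(** * Serial dictatorship *)

Section SerialDictatorship.

Variables (N M : finType).
Implicit Types (P : profile N M) (r : M -> nat).

Lemma eq_serial_dictatorship P r r' o : r =1 r' ->
  serial_dictatorship P r o =1 serial_dictatorship P r' o.
Proof.
elim: o r r' => // k o IHo r r' e i /=.
have -> : [set j | 0 < r j] = [set j | 0 < r' j].
  by apply/setP => j; rewrite !inE e.
by case: eqP => // _; apply: IHo => j; rewrite e.
Qed.

(* [s] lists agents with the objects that they are to pick. *)
Lemma serial_dictatorship_cat P r (s : seq (N * M)) o i :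
    (forall s1 p s2, s = s1 ++ p :: s2 ->
      is_top (P p.1) [set j | count (fun p => p.2 == j) s1 < r j] p.2) ->
    i \notin map fst s ->
  serial_dictatorship P r (map fst s ++ o) i =
  serial_dictatorship P (fun j => r j - count (fun p => p.2 == j) s) o i.
Proof.
elim: s r => [|p s IHs] r h /=.
  by move=> _; apply: eq_serial_dictatorship => j; rewrite subn0.
rewrite inE negb_or => /andP[/negPf-> nis].
have /topP -> := h [::] p s erefl.
rewrite IHs //.
  by apply: eq_serial_dictatorship => j; rewrite subnDA.
move=> s1 p1 s2 es; have := h (p :: s1) p1 s2; rewrite es => /(_ erefl).
congr (is_top _ _ _); apply/setP => j; rewrite !inE /=.
by rewrite ltn_subRL.
Qed.

(** The agents before [i] choose as before, so [i] faces the same objects, and by [top_swap] its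
    choice can only change from [a] to [b]. *)
Lemma serial_dictatorship_swap P r (i : N) (Pi' : pref M) a b o :
    adjacent (P i) a b ->
    (forall x y, Pi' x y = P i (tperm a b x) (tperm a b y)) ->
    serial_dictatorship [eta P with i |-> Pi'] r o i = Some a ->
  serial_dictatorship P r o i = Some a.
Proof.
move=> adj sw; elim: o r => //= k o IHo r.
have [<-|nki] := eqVneq i k.
  move=> e; apply/eqP; apply: contraT => ne.
  case: (@top_swap _ _ _ _ _ adj sw [set j | 0 < r j]) => [|_].
    by rewrite e => /esym/eqP; apply/negP.
  have [ab _] := adj; rewrite e => -[e']; by rewrite e' pref_irr in ab.
exact: IHo.
Qed.

End SerialDictatorship.

(** * The eating process and orderings that reproduce its states *)

Section ProbabilisticSerial.

Local Open Scope ring_scope.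

Variables (R : realFieldType) (N M : finType) (q : M -> nat).
Hypothesis q_gt0 : forall j : M, (0 < q j)%N.

Implicit Types (P : profile N M) (x : {ffun N -> {ffun M -> R}}) (t : R).

(* In the last clause [f] orders the objects by time of exhaustion: an agent
   turns to [j] only after the objects that it prefers to [j] are exhausted. *)
Definition ps_reachable P t x :=
  [/\ t <= 1, forall l j, 0 <= x l j, forall l, \sum_j x l j <= t,
      forall j, 0 <= left_over q x j &
      exists f : M -> nat, forall l j k, 0 < x l j -> P l k j ->
        left_over q x k = 0 /\ (f k < f j)%N].

Lemma duration_ge0 P t x : t <= 1 -> (forall j, 0 <= left_over q x j) ->
  0 <= duration q P t x.
Proof.
move=> t1 y0; apply/bigmin_geP; split=> [|j _]; first by rewrite subr_ge0.
by rewrite divr_ge0.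
Qed.

Lemma duration_le P t x : duration q P t x <= 1 - t.
Proof. exact: bigmin_le_id. Qed.

Lemma duration_eaters P t x j : 0 <= left_over q x j ->
  duration q P t x *+ eaters q P x j <= left_over q x j.
Proof.
move=> xj0; have [-> | e0] := posnP (eaters q P x j); first by rewrite mulr0n.
rewrite -mulr_natr -ler_pdivlMr ?ltr0n //; exact: bigmin_le_cond.
Qed.

Lemma left_over_step P t x j :
  left_over q (ps_step q P (t, x)).2 j =
  left_over q x j - duration q P t x *+ eaters q P x j.
Proof.
rewrite /left_over /=; set d := duration _ _ _ _.
under eq_bigr => i _ do rewrite !ffunE.
rewrite big_split /= opprD addrA; congr (_ - _).
rewrite sumrMnr; congr (_ *+ _).
rewrite /eaters -sum1_card [RHS]big_mkcond; apply: eq_bigr => i _.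
by rewrite inE; case: eqP.
Qed.

Lemma eatsP P x l j : eats q P x l = Some j ->
  0 < left_over q x j /\ forall k, P l k j -> ~~ (0 < left_over q x k).
Proof.
move/topP/is_topP; rewrite inE => -[xj h]; split=> // k kj.
apply/negP => xk; have := h k; rewrite inE => /(_ xk).
rewrite (pref_asym kj); case: eqVneq => [e|_ /(_ isT)//].
by rewrite e pref_irr in kj.
Qed.

Lemma ps_reachable0 P : ps_reachable P 0 [ffun=> [ffun=> 0]].
Proof.
split=> [|l j|l|j|]; rewrite ?ler01 ?ffunE //.
- by rewrite big1 // => j _; rewrite !ffunE.
- by rewrite /left_over big1 ?subr0 // => i _; rewrite !ffunE.
by exists (fun=> 0%N) => l j k; rewrite !ffunE ltxx.
Qed.

Lemma ps_reachable_step P t x : ps_reachable P t x ->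
  ps_reachable P (ps_step q P (t, x)).1 (ps_step q P (t, x)).2.
Proof.
case=> t1 x0 xt y0 [f fP].
have d0 := duration_ge0 P t1 y0; have d1 := duration_le P t x; split.
- by rewrite /= -lerBrDl.
- by move=> l j; rewrite !ffunE addr_ge0 // mulrn_wge0.
- move=> l /=; under eq_bigr => j _ do rewrite !ffunE.
  rewrite big_split lerD //= sumrMnr.
  case: (eats q P x l) => [c|]; last by rewrite big1 // mulr0n.
  rewrite (bigD1 c) //= eqxx big1 ?addn0 // => j jc.
  by apply/eqP; rewrite eqb0; apply: contraNneq jc => -[->].
- by move=> j; rewrite left_over_step subr_ge0 duration_eaters.
have exhausted k : ~~ (0 < left_over q x k) ->
    left_over q (ps_step q P (t, x)).2 k = 0.
  rewrite -leNgt => xk; apply/le_anti; rewrite left_over_step.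
  rewrite [0 <= _]subr_ge0 duration_eaters // andbT.
  by rewrite (le_trans _ xk) // gerBl mulrn_wge0.
(* Objects exhausted before the step keep their rank; all others move above every old rank. *)
exists (fun j => if 0 < left_over q x j then (\max_j f j).+1 else f j).
move=> l j k; rewrite !ffunE => xlj kj.
have bnd m : (f m < (\max_j f j).+1)%N by rewrite ltnS leq_bigmax.
have [xlj0 | ] := boolP (0 < x l j).
  have [xk fkj] := fP l j k xlj0 kj.
  have nk : ~~ (0 < left_over q x k) by rewrite xk ltxx.
  by split; [exact: exhausted | rewrite (negPf nk); case: ifP].
move=> nx; have {nx}xlj0 : x l j = 0 by apply/le_anti; rewrite x0 andbT leNgt.
move: xlj; rewrite xlj0 add0r; case: eqP => [|_]; last by rewrite mulr0n ltxx.
case/eatsP => xj /(_ k kj) nk _.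
by split; [exact: exhausted | rewrite (negPf nk) xj].
Qed.

Lemma ps_step1 P x : (forall j, 0 <= left_over q x j) ->
  ps_step q P (1, x) = (1, x).
Proof.
move=> y0; have d0 := duration_ge0 P (lexx 1) y0.
have := duration_le P 1 x; rewrite subrr => d1; have d : duration q P 1 x = 0 by apply/le_anti; rewrite d0 d1.
rewrite /= d addr0; congr pair; apply/ffunP => i; apply/ffunP => j.
by rewrite !ffunE mul0rn addr0.
Qed.

(** Preferences enter a step only through [eats]. *)
Lemma eq_ps_step P P' t x :
  eats q P x =1 eats q P' x -> ps_step q P (t, x) = ps_step q P' (t, x).
Proof.
move=> e; have eE : eaters q P x =1 eaters q P' x.
  by move=> j; apply: eq_card => i; rewrite !inE e.
have d : duration q P t x = duration q P' t x.
  by apply: eq_big => j; rewrite eE.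
rewrite /= d; congr pair; apply/ffunP => i; apply/ffunP => j.
by rewrite !ffunE e.
Qed.

(* Hall's condition holds because every agent has eaten at most [t < 1]: a set
   [T] of exhausted objects was eaten by more than [\sum_(j in T) q j] agents, so
   that agent [i] can be spared. *)
Lemma exhausted_matching P t x i : ps_reachable P t x -> t < 1 ->
  exists s : seq (N * M),
    [/\ uniq (map fst s), i \notin map fst s,
        forall p, p \in s -> 0 < x p.1 p.2 &
        forall j, count (fun p => p.2 == j) s =
                  if 0 < left_over q x j then 0%N else q j].
Proof.
case=> t1 x0 xt y0 _ lt_t1.
pose q' j := if 0 < left_over q x j then 0%N else q j.
(* Elements of [C] are the single units of the exhausted objects; [F] offers each unit to the eaters
   of its object other than [i]. *)
pose C : finType := {j : M & 'I_(q' j)}.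
pose F (c : C) := [set l | (l != i) && (0 < x l (tag c))].
have q'_le j : (q' j)%:R <= \sum_l x l j.
  rewrite /q'; case: ifPn => [_|]; first by rewrite sumr_ge0.
  by rewrite -leNgt /left_over subr_le0.
have hF : hall_condition F.
  move=> J; pose T := [set tag c | c in J].
  pose A := [set l | [exists j in T, 0 < x l j]].
  have JT : (#|J| <= \sum_(j in T) q' j)%N.
    have -> : (\sum_(j in T) q' j = \sum_(j in T) \sum_(c : 'I_(q' j)) 1)%N.
      by apply: eq_bigr => j _; rewrite sum1_card card_ord.
    rewrite sig_big_dep sum1_card; apply: subset_leq_card; apply/subsetP => c cJ.
    by rewrite unfold_in /= andbT; apply: imset_f.
  (* Only agents in [A] ate from [T], each at most [t] in total. *)
  have TA : (\sum_(j in T) q' j)%:R <= t *+ #|A|.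
    rewrite natr_sum; apply: le_trans (ler_sum _ (fun j _ => q'_le j)) _.
    rewrite exchange_big /= (bigID (mem A)) /= [X in _ + X]big1 ?addr0.
      rewrite -sumr_const; apply: ler_sum => l _; apply: le_trans (xt l).
      by rewrite [leRHS](bigID (mem T)) /= lerDl sumr_ge0.
    move=> l; rewrite inE => /existsPn h; apply: big1 => j jT.
    by apply/le_anti; rewrite x0 andbT leNgt; have := h j; rewrite jT.
  have FA : \bigcup_(c in J) F c = A :\ i.
    apply/setP => l; rewrite !inE; apply/bigcupP/andP.
      case=> c cJ; rewrite inE => /andP[-> xl]; split=> //.
      by apply/existsP; exists (tag c); rewrite xl imset_f.
    case=> li /existsP[j /andP[/imsetP[c cJ ->] xl]]; exists c => //.
    by rewrite inE li.
  rewrite FA; apply: leq_trans JT _.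
  have [A0 | A0] := posnP #|A|.
    by move: TA; rewrite A0 mulr0n -[0]/(0%:R) ler_nat leqn0 => /eqP->.
  (* Here [t < 1] makes the bound strict, which pays for removing [i] from [A]. *)
  have : (\sum_(j in T) q' j < #|A|)%N.
    rewrite -(ltr_nat R); apply: le_lt_trans TA _.
    by rewrite -[ltLHS]mulr_natr gtr_pMl // ltr0n.
  rewrite (cardsD1 i A) => h; rewrite -ltnS; apply: leq_trans h _.
  by rewrite -add1n leq_add2r leq_b1.
have [f f_inj fF] := hall hF.
exists [seq (f c, tag c) | c <- enum C]; split.
- by rewrite -map_comp map_inj_uniq ?enum_uniq.
- rewrite -map_comp; apply/mapP => -[c _ /= e].
  by have := fF c; rewrite inE -e eqxx.
- by move=> p /mapP[c _ ->] /=; have := fF c; rewrite inE => /andP[].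
move=> j; rewrite count_map /= -/(q' j).
transitivity (\sum_(k | k == j) \sum_(c : 'I_(q' k)) 1)%N; last first.
  by rewrite big_pred1_eq sum1_card card_ord.
rewrite sig_big_dep -sum1_count big_enum_cond /=.
by apply: eq_bigl => c; rewrite andbT.
Qed.

(** The ordering is chosen before [P'], so that one ordering serves the profiles before and after
    the swap. *)
Lemma ordering_of_eating P t x i : ps_reachable P t x -> t < 1 ->
  exists2 o, o \in permutations (enum N) &
    forall P', (forall l, l != i -> P' l = P l) ->
      serial_dictatorship P' q o i = eats q P' x i.
Proof.
move=> inv lt_t1; have [s0 [s0_uniq s0_i s0_x s0_q]] := exhausted_matching i inv lt_t1.
case: inv => _ _ _ y0 [f fP].
pose le (p p' : N * M) := (f p.2 <= f p'.2)%N.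
pose s := sort le s0.
have ss0 : perm_eq s s0 by rewrite perm_sort.
have sq j : count (fun p => p.2 == j) s = if 0 < left_over q x j then 0%N else q j.
  by rewrite (seq.permP ss0).
have s_uniq : uniq (map fst s) by rewrite (perm_uniq (perm_map _ ss0)).
have s_i : i \notin map fst s by rewrite (perm_mem (perm_map _ ss0)).
have s_le : pairwise le s.
  rewrite -sorted_pairwise => [|p1 p2 p3]; last exact: leq_trans.
  by apply: sort_sorted => p1 p2; apply: leq_total.
pose rest := [seq l <- enum N | l \notin i :: map fst s].
exists (map fst s ++ i :: rest).
  rewrite mem_permutations; apply: uniq_perm; rewrite ?enum_uniq //.
    rewrite cat_uniq s_uniq /= mem_filter mem_head /= filter_uniq ?enum_uniq // andbT.
    rewrite negb_or s_i; apply/hasPn => l; rewrite mem_filter inE negb_or.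
    by case/andP => /andP[].
  move=> l; rewrite mem_cat inE mem_filter mem_enum inE negb_or !andbT.
  by case: (l \in map fst s); case: (l == i).
move=> P' eP; rewrite serial_dictatorship_cat //.
  (* After [s], exhausted objects have no unit left and the others still have all [q j > 0]
     units. *)
  rewrite /= eqxx /eats; congr top; apply/setP => j; rewrite !inE sq.
  by case: ifP => _; rewrite ?subn0 ?subnn ?q_gt0.
move=> s1 [l j] s2 es /=; rewrite eP; last first.
  apply: contraNneq s_i => <-; rewrite es map_cat mem_cat /= mem_head orbT //.
have xlj : 0 < x l j.
  by apply: (s0_x (l, j)); rewrite -(perm_mem ss0) es mem_cat mem_head orbT.
apply/is_topP; rewrite inE; split.
  have : (count (fun p => p.2 == j) s <= q j)%N by rewrite sq; case: ifP.
  by apply: leq_trans; rewrite es count_cat /= eqxx addnS ltnS leq_addr.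
(* If [l] preferred [k] to [j], then [k] would be exhausted with smaller rank, so by sorting all its
   [q k] units would be taken within [s1]. *)
move=> k; rewrite inE => lt_k kj; have /orP[/(fP l j k xlj)|//] := pref_total (P l) kj.
case=> xk fkj; move: lt_k; have := sq k; rewrite xk ltxx => <-.
rewrite es count_cat [X in (_ + X)%N](_ : _ = 0%N) ?addn0 ?ltnn //.
apply/eqP; rewrite -leqn0 leqNgt -has_count -all_predC /= eq_sym kj /=.
move: s_le; rewrite es pairwise_cat /= => /and3P[_ _ /andP[js2 _]].
apply: sub_all js2 => p le_jp; apply: contraTneq fkj => <-.
by rewrite -leqNgt.
Qed.

(** * Comparison of the two mechanisms *)

Lemma RSD_eq_count (phi psi : profile N M) (i : N) j :
    RSD R N q phi i = RSD R N q psi i ->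
  count (fun o => serial_dictatorship phi q o i == Some j) (permutations (enum N)) =
  count (fun o => serial_dictatorship psi q o i == Some j) (permutations (enum N)).
Proof.
move=> /ffunP/(_ j); rewrite !ffunE => /(mulIf _) e.
apply/eqP; rewrite -(eqr_nat R); apply/eqP/e.
by rewrite invr_eq0 pnatr_eq0 -lt0n fact_gt0.
Qed.

(** The orderings giving [a] to [i] after the swap are among those doing so before it; equal counts
    force the two sets to coincide. *)
Lemma RSD_swap P i (Pi' : pref M) a b : adjacent (P i) a b ->
    (forall y z, Pi' y z = P i (tperm a b y) (tperm a b z)) ->
    RSD R N q P i = RSD R N q [eta P with i |-> Pi'] i ->
  forall o, o \in permutations (enum N) ->
    serial_dictatorship P q o i = Some a ->
    serial_dictatorship [eta P with i |-> Pi'] q o i = Some a.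
Proof.
move=> adj sw /(RSD_eq_count a) e o oN ha; apply/eqP; apply: contraT => ne.
set c := count _ _ in e; set c' := count _ _ in e.
suff : (c' < c)%N by rewrite e ltnn.
rewrite /c (_ : count _ _ = c' + count (fun o =>
    (serial_dictatorship P q o i == Some a) &&
    (serial_dictatorship [eta P with i |-> Pi'] q o i != Some a))
    (permutations (enum N)))%N.
  by rewrite -addn1 leq_add2l -has_count; apply/hasP; exists o; rewrite // ha eqxx.
rewrite -count_predUI [X in (_ + X)%N](_ : _ = 0%N).
  rewrite addn0; apply: eq_count => o' /=.
  case: eqP => [_|ne'] /=; first by case: eqP.
  apply/esym/negbTE; rewrite orbF.
  by apply/eqP => /(serial_dictatorship_swap adj sw).
apply/eqP; rewrite -leqn0 leqNgt -has_count; apply/hasPn => o' _ /=.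
by case: eqP; rewrite ?andbF.
Qed.

End ProbabilisticSerial.

Theorem theorem3 (R : realFieldType) (N M : finType) (q : M -> nat)
    (q_gt0 : forall j : M, 0 < q j)
    (q_enough : #|N| <= \sum_(j : M) q j) :
  weakly_less_varying (PS R N q) (RSD R N q).
Proof.
move=> i P Pi' [a [b [adj sw]]] eqRSD; rewrite /PS; set s0 := (_, _).
set P' := [eta P with i |-> Pi'].
(* The two runs agree step by step, so the invariant is needed for [P] only. *)
suff: forall n, ps_reachable q P (iter n (ps_step q P) s0).1
                    (iter n (ps_step q P) s0).2 /\
      iter n (ps_step q P) s0 = iter n (ps_step q P') s0.
  by case/(_ #|M|) => _ ->.
elim=> [|n]; first by split=> //; apply: ps_reachable0.
rewrite !iterS; case: (iter n _ _) => t x [inv <-]; rewrite /= in inv.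
split; first exact: ps_reachable_step.
have [lt_t1 | ] := boolP (t < 1)%R.
  apply: eq_ps_step => l; have [->|nl] := eqVneq l i; last first.
    by rewrite /eats /P' /= (negPf nl).
  have [o oN eo] := ordering_of_eating q_gt0 i inv lt_t1.
  (* Were the choices of [i] to differ, [o] would give it [a] before the swap and [b] after, against
     [RSD_swap]. *)
  apply/eqP; apply: contraT => /eqP ne.
  have [|aT bT] := @top_swap _ _ _ _ _ adj sw [set j | 0 < left_over q x j]%R.
    by move=> e; apply: ne; rewrite /eats /P' /= eqxx e.
  have := RSD_swap adj sw eqRSD oN; rewrite !eo => [|l' /negPf /= ->|] //.
  rewrite /eats /= eqxx aT bT => /(_ erefl) [e].
  by have [] := adj; rewrite e pref_irr.
case: inv => t1 _ _ y0 _; rewrite lt_neqAle t1 andbT negbK => /eqP ->.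
by rewrite !ps_step1.
Qed.
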